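(* Let $C$ be a commutative ring, $\lambda\in C$, and let $Ш_C(X)$ be the free Baxter algebra of weight $\lambda$ on $C[x]$. For $n\ge1$ let $S(n,I)\in C$ (for $I\in\mathcal{I}$ with $|I|=n$) be the coefficients determined by $$(1\otimes x)^n=\sum_{|I|=n}S(n,I)\,(1\otimes x^{\otimes I})\quad\text{in } Ш_C(X).$$ Then, for all $n\ge 1$: (1) For $I=(i_1,\dots,i_k)\in\mathcal{I}$ with $|I|=n$ and $I>0$, $$S(n,I)=\binom{n}{i_1,\dots,i_k}\lambda^{n-\ell(I)}.$$ (2) For $1\le k\le n$, $$\sum_{|I|=n,\ \ell(I)=k}S(n,I)=k!\,S(n,k)\,\lambda^{n-k},$$ where $S(n,k)$ on the right-hand side is the Stirling number of the second kind.
   Context: Rings and algebras have an identity $1$. For a commutative $C$-algebra $A$, the free (commutative) Baxter algebra of weight $\lambda$ on $A$ is realized as the mixable shuffle Baxter algebra: as a $C$-module it is $\bigoplus_{n\ge1}A^{\otimes n}$ (tensor products over $C$); its multiplication $\diamond$ (written as juxtaposition) is the $C$-bilinear product given recursively by $a_0\diamond(b_0\otimes b_1\otimes\cdots\otimes b_n)=a_0b_0\otimes b_1\otimes\cdots\otimes b_n$, $(a_0\otimes a_1\otimes\cdots\otimes a_m)\diamond b_0=a_0b_0\otimes a_1\otimes\cdots\otimes a_m$, and, for $m,n\ge1$, $(a_0\otimes a_1\otimes\cdots\otimes a_m)\diamond(b_0\otimes b_1\otimes\cdots\otimes b_n)=a_0b_0\otimes\big((a_1\otimes\cdots\otimes a_m)\diamond(1\otimes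 b_1\otimes\cdots\otimes b_n)\big)+a_0b_0\otimes\big((1\otimes a_1\otimes\cdots\otimes a_m)\diamond(b_1\otimes\cdots\otimes b_n)\big)+\lambda\,a_0b_0\otimes\big((a_1\otimes\cdots\otimes a_m)\diamond(b_1\otimes\cdots\otimes b_n)\big)$ for $a_i,b_j\in A$; its Baxter operator is $P_A(a_1\otimes\cdots\otimes a_m)=1\otimes a_1\otimes\cdots\otimes a_m$. For $A=C[x]$ this algebra is denoted $Ш_C(X)$, $X=\{x\}$, with operator $P_X$. Let $\mathcal{I}=\{I=(i_1,\dots,i_k)\mid k\ge1,\ i_s\ge0 \text{ integers}\}$. For $I=(i_1,\dots,i_k)\in\mathcal{I}$ put $|I|=i_1+\cdots+i_k$, $\ell(I)=k$, and $x^{\otimes I}=x^{i_1}\otimes\cdots\otimes x^{i_k}$; write $I>0$ if all $i_s>0$. The elements $x^{\otimes I}$, $I\in\mathcal{I}$, form a $C$-basis of $Ш_C(X)$, and $P_X(Ш_C(X))$ is closed under multiplication and has $C$-basis $\{1\otimes x^{\otimes I}\mid I\in\mathcal{I}\}$; the power $(1\otimes x)^n$ (for the product $\diamond$) is a finite $C$-linear combination of those $1\otimes x^{\otimes I}$ with $|I|=n$, so $S(n,I)$ is well defined (all but finitely many are $0$). $\binom{n}{i_1,\dots,i_k}=\frac{n!}{i_1!\cdots i_k!}$ is the multinomial coefficient. The Stirling numbers of the second kind $S(n,k)$ ($k$ an integer) are defined by $t^n=\sum_{k=0}^nS(n,k)\,t(t-1)\cdots(t-k+1)$. *)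

(* Defs.v *)
From HB Require Import structures.
From mathcomp Require Import all_boot all_algebra finmap.
From mathcomp Require Import boolp monalg zify.

Set Implicit Arguments.
Unset Strict Implicit.
Unset Printing Implicit Defensive.

Import GRing.Theory.
Local Open Scope ring_scope.

(* The C-module \bigoplus_(n >= 1) M^{\otimes n}: the free C-module on the      *)
(* nonempty words over M modulo the relations making a_0 \otimes ... \otimes a_n *)
(* C-multilinear. The nonempty word (a_0, ..., a_n) is encoded as the pair       *)
(* (a_0, [:: a_1; ...; a_n]).                                                    *)
Section TensorModule.
Variables (C : comNzRingType) (M : lmodType C).
Implicit Types (a b : M) (u v : seq M) (c : C).

Definition word := (M * seq M)%type.

Definition multilinear (V : lmodType C) (h : M -> seq M -> V) : Prop :=
  (forall c a a' u, h (c *: a + a') u = c *: h a u + h a' u) /\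
  (forall b u c a a' v,
     h b (u ++ (c *: a + a') :: v) = c *: h b (u ++ a :: v) + h b (u ++ a' :: v)).

Notation F := {malg C[word]}.
Notation wd a u := (<< (a, u) >> : F).

Inductive tensor_rel : F -> Prop :=
| TensorRelHead c a a' u :
    tensor_rel (wd (c *: a + a') u - (c *: wd a u + wd a' u))
| TensorRelTail b u c a a' v :
    tensor_rel (wd b (u ++ (c *: a + a') :: v)
                - (c *: wd b (u ++ a :: v) + wd b (u ++ a' :: v))).

Inductive tensor_span : F -> Prop :=
| TensorSpan0 : tensor_span 0
| TensorSpanD c r f :
    tensor_rel r -> tensor_span f -> tensor_span (c *: r + f).

Definition tensor_null : {pred F} := fun f => `[< tensor_span f >].

Lemma tensor_nullP f : reflect (tensor_span f) (f \in tensor_null).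
Proof. exact: asboolP. Qed.

Lemma tensor_nullD c f g :
  f \in tensor_null -> g \in tensor_null -> c *: f + g \in tensor_null.
Proof.
move=> /tensor_nullP Hf /tensor_nullP Hg; apply/tensor_nullP.
elim: Hf => [|d r f' Hr _ IH]; first by rewrite scaler0 add0r.
by rewrite scalerDr scalerA -addrA; apply: TensorSpanD.
Qed.

Lemma tensor_null0 : 0 \in tensor_null.
Proof. by apply/tensor_nullP; constructor. Qed.

Lemma tensor_null_rel r : tensor_rel r -> r \in tensor_null.
Proof.
move=> Hr; apply/tensor_nullP; rewrite -[r]scale1r -[1 *: r]addr0.
by apply: TensorSpanD => //; constructor.
Qed.

Lemma tensor_null_closed : zmod_closed tensor_null.
Proof.
split=> [|f g Hf Hg]; first exact: tensor_null0.
by rewrite addrC -scaleN1r tensor_nullD.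
Qed.

HB.instance Definition _ := GRing.isZmodClosed.Build F tensor_null
  tensor_null_closed.

Definition tens : Type := Quotient.quot tensor_null.

Fact tens_key : unit. Proof. by []. Qed.

(* The operations are locked for the sake of unification. *)
Definition tadd : tens -> tens -> tens :=
  locked_with tens_key (@Quotient.add F tensor_null).
Definition topp : tens -> tens :=
  locked_with tens_key (@Quotient.opp F tensor_null).
Definition tzero : tens :=
  locked_with tens_key (@Quotient.zero F tensor_null).

Fact taddA : associative tadd.
Proof. by rewrite /tadd locked_withE; apply: Quotient.addqA. Qed.
Fact taddC : commutative tadd.
Proof. by rewrite /tadd locked_withE; apply: Quotient.addqC. Qed.
Fact tadd0 : left_id tzero tadd.
Proof. by rewrite /tadd /tzero !locked_withE; apply: Quotient.add0q. Qed.
Fact taddN : left_inverse tzero topp tadd.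
Proof. by rewrite /tadd /tzero /topp !locked_withE; apply: Quotient.addNq. Qed.

HB.instance Definition _ := Choice.copy tens (Quotient.quot tensor_null).
HB.instance Definition _ := GRing.isZmodule.Build tens taddA taddC tadd0 taddN.

Local Open Scope quotient_scope.
Definition tclass : F -> tens :=
  locked_with tens_key (fun f => \pi_(Quotient.quot tensor_null) f).
Definition trepr : tens -> F :=
  locked_with tens_key (fun t => repr (t : Quotient.quot tensor_null)).

Lemma treprK t : tclass (trepr t) = t.
Proof. by rewrite /tclass /trepr !locked_withE; apply: reprK. Qed.

Lemma tclassP f g : tclass f = tclass g <-> f - g \in tensor_null.
Proof.
rewrite /tclass locked_withE; split => [/eqP|];
  rewrite (Quotient.idealrBE tensor_null) => //.
by move/eqP.
Qed.

Lemma tclassD f g : tclass (f + g) = tclass f + tclass g.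
Proof.
rewrite -[RHS]/(tadd _ _) /tadd /tclass !locked_withE.
exact: raddfD (\pi_(Quotient.quot tensor_null)) f g.
Qed.

Definition tscale : C -> tens -> tens :=
  locked_with tens_key (fun c t => tclass (c *: trepr t)).

Lemma tclassZ c f : tclass (c *: f) = tscale c (tclass f).
Proof.
rewrite /tscale locked_withE; apply/tclassP.
rewrite -scalerBr -[_ *: _]addr0 tensor_nullD ?tensor_null0 //.
by apply/tclassP; rewrite treprK.
Qed.

Fact tscaleA c d t : tscale c (tscale d t) = tscale (c * d) t.
Proof. by rewrite -(treprK t) -!tclassZ scalerA. Qed.

Fact tscale1 : left_id 1 tscale.
Proof. by move=> t; rewrite -(treprK t) -!tclassZ scale1r. Qed.

Fact tscaleDr : right_distributive tscale +%R.
Proof.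
by move=> c s t; rewrite -(treprK s) -(treprK t) -!(tclassZ, tclassD) scalerDr.
Qed.

Fact tscaleDl t : {morph tscale^~ t : c d / c + d}.
Proof. by move=> c d; rewrite -(treprK t) -!(tclassZ, tclassD) scalerDl. Qed.

HB.instance Definition _ := GRing.Zmodule_isLmodule.Build C tens
  tscaleA tscale1 tscaleDr tscaleDl.

Lemma tclass_linear c f g : tclass (c *: f + g) = c *: tclass f + tclass g.
Proof. by rewrite tclassD tclassZ. Qed.

Lemma tclass0 : tclass 0 = 0.
Proof. by rewrite -[RHS](scale0r (tclass 0)) -[0 *: _]tclassZ scale0r. Qed.

(* pure a_0 [:: a_1; ...; a_n] is a_0 \otimes a_1 \otimes ... \otimes a_n. *)
Definition pure : M -> seq M -> tens :=
  locked_with tens_key (fun a u => tclass (wd a u)).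

Lemma pureE a u : pure a u = tclass (wd a u).
Proof. by rewrite /pure locked_withE. Qed.

Lemma pure_multilinear : multilinear pure.
Proof.
split=> [c a a' u|b u c a a' v]; rewrite !pureE.
  apply: etrans (tclass_linear _ _ _).
  exact/tclassP/tensor_null_rel/TensorRelHead.
apply: etrans (tclass_linear _ _ _).
exact/tclassP/tensor_null_rel/TensorRelTail.
Qed.

Section Lift.
Variables (V : lmodType C) (h : M -> seq M -> V).

Definition fext (f : F) : V := \sum_(k <- msupp f) f@_k *: h k.1 k.2.

Lemma fextEw (D : {fset word}) f :
  (msupp f `<=` D)%fset -> fext f = \sum_(k <- D) f@_k *: h k.1 k.2.
Proof.
move=> sfD; rewrite /fext; apply/big_fset_incl => // k _ kNf.
by rewrite mcoeff_outdom // scale0r.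
Qed.

Lemma fext_linear c f g : fext (c *: f + g) = c *: fext f + fext g.
Proof.
pose D := (msupp f `|` msupp g `|` msupp (c *: f + g))%fset.
have [sf sg sfg] : [/\ msupp f `<=` D, msupp g `<=` D
    & msupp (c *: f + g) `<=` D]%fset.
  by split; apply/fsubsetP => k; rewrite !in_fsetU => ->; rewrite ?orbT.
rewrite (fextEw sf) (fextEw sg) (fextEw sfg) scaler_sumr -big_split /=.
by apply: eq_bigr => k _; rewrite mcoeffD mcoeffZ scalerDl scalerA.
Qed.

Lemma fextB f g : fext (f - g) = fext f - fext g.
Proof.
have -> : f - g = -1 *: g + f by rewrite scaleN1r addrC.
by rewrite fext_linear scaleN1r addrC.
Qed.

Lemma fextU a u : fext (wd a u) = h a u.
Proof.
by rewrite (fextEw msuppU_le) big_seq_fset1 mcoeffUU scale1r.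
Qed.

Lemma fext0 : fext 0 = 0.
Proof. by rewrite /fext msupp0 big_seq_fset0. Qed.

(* The linear map on tens induced by h, when h is multilinear. *)
Definition tlift : tens -> V :=
  locked_with tens_key (fun t => fext (trepr t)).

Hypothesis h_ml : multilinear h.

Lemma fext_null f : f \in tensor_null -> fext f = 0.
Proof.
move/tensor_nullP; elim=> [|c r g Hr _ IH]; first exact: fext0.
rewrite fext_linear IH addr0.
suff -> : fext r = 0 by rewrite scaler0.
case: Hr => [d a a' u|b u d a a' v]; rewrite fextB fext_linear !fextU.
  by rewrite (proj1 h_ml) subrr.
by rewrite (proj2 h_ml) subrr.
Qed.

Lemma tlift_class f : tlift (tclass f) = fext f.
Proof.
rewrite /tlift locked_withE; apply/eqP; rewrite -subr_eq0 -fextB; apply/eqP/fext_null/tclassP.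
by rewrite treprK.
Qed.

Lemma tlift_pure a u : tlift (pure a u) = h a u.
Proof. by rewrite pureE tlift_class fextU. Qed.

Lemma tlift_linear c s t : tlift (c *: s + t) = c *: tlift s + tlift t.
Proof.
rewrite -(treprK s) -(treprK t) -tclass_linear !tlift_class.
exact: fext_linear.
Qed.

Lemma tlift0 : tlift 0 = 0.
Proof. by have := tlift_linear (-1) 0 0; rewrite !scaleN1r !addNr. Qed.

End Lift.

Lemma tens_ind (P : tens -> Prop) :
  P 0 -> (forall c a u t, P t -> P (c *: pure a u + t)) -> forall t, P t.
Proof.
move=> P0 PS t; rewrite -(treprK t) [trepr t]monalgE.
elim: (enum_fset _) => [|[a u] s IH]; first by rewrite big_nil tclass0.
rewrite big_cons; set c := _@_ _; set S := \sum_(_ <- _) _ in IH *.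
suff -> : << c *g (a, u) >> = c *: wd a u by rewrite tclass_linear -pureE; apply: PS.
by apply/malgP => k; rewrite mcoeffZ !mcoeffU mulrnAr mulr1.
Qed.

End TensorModule.

Section LinearCombinations.
Variables (C : comNzRingType) (V : lmodType C).
Implicit Types x y z : V.

Lemma lincomb2 (d e : C) x x' y y' :
  e *: (d *: x + y) + (d *: x' + y') = d *: (e *: x + x') + (e *: y + y').
Proof. by rewrite !scalerDr !scalerA [e * d]mulrC addrACA. Qed.

Lemma lincomb3 (d e : C) x y x' y' x'' y'' :
  (d *: x + y) + (d *: x' + y') + e *: (d *: x'' + y'') =
  d *: (x + x' + e *: x'') + (y + y' + e *: y'').
Proof.
rewrite !scalerDr !scalerA [e * d]mulrC !addrA.
by rewrite [LHS](ACl (1*3*5*2*4*6)).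
Qed.

End LinearCombinations.

Section MixableShuffleProduct.
Variables (C : comNzRingType) (lam : C) (A : comAlgType C).
Implicit Types (a b c : A) (u v w : seq A) (s t r : tens A).

(* tcons a_0 (a_1 \otimes ... \otimes a_n) = a_0 \otimes a_1 \otimes ... \otimes a_n *)
Definition tcons : A -> tens A -> tens A :=
  locked_with tens_key (fun a => tlift (fun b v => pure a (b :: v))).

Lemma tcons_ml a : multilinear (fun b v => pure a (b :: v)).
Proof.
have [_ Ht] := pure_multilinear A; split=> [d b b' u|b u d c c' v].
  exact: (Ht a [::]).
exact: (Ht a (b :: u)).
Qed.

Lemma tcons_pure a b v : tcons a (pure b v) = pure a (b :: v).
Proof. by rewrite /tcons locked_withE (tlift_pure (tcons_ml a)). Qed.

Lemma tcons_linear a (d : C) s t :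
  tcons a (d *: s + t) = d *: tcons a s + tcons a t.
Proof. by rewrite /tcons locked_withE (tlift_linear (tcons_ml a)). Qed.

Lemma tcons0 a : tcons a 0 = 0.
Proof. by have := tcons_linear a (-1) 0 0; rewrite !scaleN1r !addNr. Qed.

Lemma tconsD a s t : tcons a (s + t) = tcons a s + tcons a t.
Proof. by have := tcons_linear a 1 s t; rewrite !scale1r. Qed.

Lemma tconsZ a (d : C) s : tcons a (d *: s) = d *: tcons a s.
Proof. by have := tcons_linear a d s 0; rewrite tcons0 !addr0. Qed.

Lemma tcons_linearl (d : C) a a' t :
  tcons (d *: a + a') t = d *: tcons a t + tcons a' t.
Proof.
elim/tens_ind: t => [|e b u t IH]; first by rewrite !tcons0 scaler0 addr0.
rewrite !tcons_linear IH !tcons_pure (proj1 (pure_multilinear A)).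
exact: lincomb2.
Qed.

(* wmul [:: a_1; ...; a_m] a_0 b_0 [:: b_1; ...; b_n] is the product of          *)
(* a_0 \otimes ... \otimes a_m and b_0 \otimes ... \otimes b_n.                   *)
Fixpoint wmul u : A -> A -> seq A -> tens A :=
  if u is a1 :: u' then
    fix wmulr a0 b0 v :=
      if v is b1 :: v' then
        tcons (a0 * b0)
          (wmul u' a1 1 v + wmulr 1 b1 v' + lam *: wmul u' a1 b1 v')
      else pure (a0 * b0) u
  else fun a0 b0 v => pure (a0 * b0) v.

Definition shmul : tens A -> tens A -> tens A :=
  locked_with tens_key (fun s t => tlift (fun a u => tlift (wmul u a) t) s).

Lemma wmulr0 u a b : wmul u a b [::] = pure (a * b) u.
Proof. by case: u. Qed.

Lemma wmul_cons a0 a1 u b0 b1 v :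
  wmul (a1 :: u) a0 b0 (b1 :: v) =
  tcons (a0 * b0) (wmul u a1 1 (b1 :: v) + wmul (a1 :: u) 1 b1 v
                   + lam *: wmul u a1 b1 v).
Proof. by []. Qed.

Lemma wmul0l a b v : wmul [::] a b v = pure (a * b) v.
Proof. by []. Qed.

Lemma wmulC u a b v : wmul u a b v = wmul v b a u.
Proof.
elim: u a b v => [|a1 u IHu] a b v; first by rewrite wmulr0 wmul0l mulrC.
elim: v a b => [|b1 v IHv] a b; first by rewrite wmulr0 wmul0l mulrC.
rewrite !wmul_cons [a * b]mulrC; congr tcons.
by rewrite (IHv 1 b1) !(IHu a1) [wmul _ 1 _ _ + _]addrC.
Qed.

Lemma wmul_mlr u a : multilinear (wmul u a).
Proof.
have head u' a' (d : C) b b' v :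
  wmul u' a' (d *: b + b') v = d *: wmul u' a' b v + wmul u' a' b' v.
  have E : a' * (d *: b + b') = d *: (a' * b) + a' * b'.
    by rewrite mulrDr scalerAr.
  case: u' v => [|a1 u'] [|b1 v]; rewrite ?wmul_cons ?wmulr0 ?wmul0l E ?tcons_linearl //;
    exact: (proj1 (pure_multilinear A)).
split=> [d b b' v|]; first exact: head.
elim: u a => [|a1 u IHu] a b w d c c' v.
  rewrite !wmul0l; exact: (proj2 (pure_multilinear A)).
elim: w a b => [|w0 w IHw] a b.
  rewrite !cat0s !wmul_cons; apply: etrans (tcons_linear _ _ _ _).
  by rewrite (IHu a1 1 [::]) (head (a1 :: u)) (head u) lincomb3.
rewrite !cat_cons !wmul_cons; apply: etrans (tcons_linear _ _ _ _).
by rewrite (IHu a1 1 (w0 :: w)) IHw (IHu a1 w0 w) lincomb3.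
Qed.

Lemma wmul_mll b v : multilinear (fun a u => wmul u a b v).
Proof.
have [H1 H2] := wmul_mlr v b.
split=> [d a a' u|a u d c c' w]; rewrite wmulC ?H1 ?H2.
  by rewrite ![wmul v b _ _]wmulC.
by rewrite ![wmul v b _ _]wmulC.
Qed.

Lemma shmul_ml t : multilinear (fun a u => tlift (wmul u a) t).
Proof.
elim/tens_ind: t => [|e b v t [IH1 IH2]].
  by split=> *; rewrite !(tlift0 (wmul_mlr _ _)) scaler0 addr0.
have [H1 H2] := wmul_mll b v.
split=> [d a a' u|a u d c c' w]; rewrite !(tlift_linear (wmul_mlr _ _)).
  rewrite !(tlift_pure (wmul_mlr _ _)) H1 IH1.
  exact: lincomb2.
rewrite !(tlift_pure (wmul_mlr _ _)) H2 IH2.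
exact: lincomb2.
Qed.

Lemma shmul_pureE a u t : shmul (pure a u) t = tlift (wmul u a) t.
Proof. by rewrite /shmul locked_withE (tlift_pure (shmul_ml _)). Qed.

Lemma shmul_pure a u b v : shmul (pure a u) (pure b v) = wmul u a b v.
Proof.
by rewrite shmul_pureE (tlift_pure (wmul_mlr _ _)).
Qed.

Lemma shmul_linearl (d : C) s t r :
  shmul (d *: s + t) r = d *: shmul s r + shmul t r.
Proof. by rewrite /shmul locked_withE (tlift_linear (shmul_ml r)). Qed.

Lemma shmul0l t : shmul 0 t = 0.
Proof. by have := shmul_linearl (-1) 0 0 t; rewrite !scaleN1r !addNr. Qed.

Lemma shmulDl s t r : shmul (s + t) r = shmul s r + shmul t r.
Proof. by have := shmul_linearl 1 s t r; rewrite !scale1r. Qed.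

Lemma shmulZl (d : C) s r : shmul (d *: s) r = d *: shmul s r.
Proof. by have := shmul_linearl d s 0 r; rewrite shmul0l !addr0. Qed.

Lemma shmul_linearr (d : C) s t r :
  shmul r (d *: s + t) = d *: shmul r s + shmul r t.
Proof.
elim/tens_ind: r => [|e a u r IH]; first by rewrite !shmul0l scaler0 addr0.
rewrite !shmul_linearl IH !shmul_pureE (tlift_linear (wmul_mlr _ _)).
exact: lincomb2.
Qed.

Lemma shmul0r t : shmul t 0 = 0.
Proof. by have := shmul_linearr (-1) 0 0 t; rewrite !scaleN1r !addNr. Qed.

Fact shmulC : commutative shmul.
Proof.
move=> s t; elim/tens_ind: s => [|d a u s IH]; first by rewrite shmul0l shmul0r.
rewrite shmul_linearl shmul_linearr IH; congr (_ *: _ + _) => {IH}.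
elim/tens_ind: t => [|e b v t IH]; first by rewrite shmul0l shmul0r.
by rewrite shmul_linearl shmul_linearr IH !shmul_pure wmulC.
Qed.

Lemma shmulDr s t r : shmul r (s + t) = shmul r s + shmul r t.
Proof. by rewrite ![shmul r _]shmulC shmulDl. Qed.

Lemma shmulZr (d : C) s r : shmul r (d *: s) = d *: shmul r s.
Proof. by rewrite ![shmul r _]shmulC shmulZl. Qed.

Lemma shmul_e_tcons a b t : shmul (pure a [::]) (tcons b t) = tcons (a * b) t.
Proof.
elim/tens_ind: t => [|d c u t IH]; first by rewrite !tcons0 shmul0r.
by rewrite !tcons_linear shmul_linearr IH !tcons_pure shmul_pure wmul0l.
Qed.

Lemma shmul_eA a s t :
  shmul (shmul (pure a [::]) s) t = shmul (pure a [::]) (shmul s t).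
Proof.
elim/tens_ind: s => [|d b u s IH]; first by rewrite !(shmul0l, shmul0r).
rewrite !(shmul_linearl, shmul_linearr) IH; congr (_ *: _ + _) => {IH}.
elim/tens_ind: t => [|e c v t IH]; first by rewrite !(shmul0l, shmul0r).
rewrite !(shmul_linearl, shmul_linearr) IH; congr (_ *: _ + _) => {IH}.
rewrite !shmul_pure.
case: u v => [|b1 u] [|c1 v];
  by rewrite ?wmul_cons ?wmul0l ?wmulr0 ?shmul_pure ?shmul_e_tcons ?wmul0l mulrA.
Qed.

Fact shmul1 : left_id (pure 1 [::]) shmul.
Proof.
move=> t; elim/tens_ind: t => [|d b v t IH]; first exact: shmul0r.
by rewrite shmul_linearr IH shmul_pure wmul0l mul1r.
Qed.

Lemma tcons_baxter s t :
  shmul (tcons 1 s) (tcons 1 t) =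
  tcons 1 (shmul s (tcons 1 t) + shmul (tcons 1 s) t + lam *: shmul s t).
Proof.
elim/tens_ind: s => [|d a u s IH].
  by rewrite !(tcons0, shmul0l, scaler0, addr0).
rewrite !(tcons_linear, shmul_linearl) IH.
suff -> : shmul (tcons 1 (pure a u)) (tcons 1 t) =
  tcons 1 (shmul (pure a u) (tcons 1 t) + shmul (tcons 1 (pure a u)) t
           + lam *: shmul (pure a u) t).
  by rewrite -[LHS]tcons_linear lincomb3.
elim/tens_ind: t {s IH} => [|e b v t IH].
  by rewrite !(tcons0, shmul0r, scaler0, addr0).
rewrite !(tcons_linear, shmul_linearr) IH !tcons_pure !shmul_pure.
by rewrite wmul_cons mulr1 -[LHS]tcons_linear lincomb3.
Qed.

Lemma shmul_baxterA s t r :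
  let P := tcons 1 in let m := shmul in
  let assoc x y z := m (m x y) z = m x (m y z) in
  assoc s (P t) (P r) -> assoc (P s) t (P r) -> assoc s t (P r) ->
  assoc (P s) (P t) r -> assoc s (P t) r -> assoc (P s) t r -> assoc s t r ->
  assoc (P s) (P t) (P r).
Proof.
move=> P m assoc; rewrite /assoc => E1 E2 E3 E4 E5 E6 E7.
have B x y : m (P x) (P y) = P (m x (P y) + m (P x) y + lam *: m x y).
  exact: tcons_baxter.
have EL : m (m (P s) (P t)) (P r) =
  let X := m s (P t) + m (P s) t + lam *: m s t in
  P (m X (P r) + m (m (P s) (P t)) r + lam *: m X r).
  by rewrite /= [in LHS](B s t) B -(B s t).
have ER : m (P s) (m (P t) (P r)) =
  let Y := m t (P r) + m (P t) r + lam *: m t r in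
  P (m s (m (P t) (P r)) + m (P s) Y + lam *: m s Y).
  by rewrite /= [in LHS](B t r) B -(B t r).
rewrite EL ER /=; congr (tcons 1 _).
rewrite /m !(shmulDl, shmulDr, shmulZl, shmulZr) -/m.
rewrite E1 E2 E3 E4 E5 E6 E7 !scalerDr !addrA.
by rewrite [LHS](ACl (1*2*4*6*3*5*7)).
Qed.

Lemma shmulA_pure n a u b v c w : (size u + size v + size w <= n)%N ->
  shmul (shmul (pure a u) (pure b v)) (pure c w) =
  shmul (pure a u) (shmul (pure b v) (pure c w)).
Proof.
elim: n a u b v c w => [|n IH] a u b v c w le_n.
all: case: u le_n => [|a1 u] le_n; first by rewrite shmul_eA.
  by [].
case: v le_n => [|b1 v] le_n.
  rewrite [shmul (pure a _) _]shmulC !shmul_eA.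
  by rewrite [RHS]shmulC shmul_eA [shmul (pure c _) _]shmulC.
case: w le_n => [|c1 w] le_n.
  rewrite [LHS]shmulC [shmul (pure b _) (pure c _)]shmulC [RHS]shmulC shmul_eA.
  by rewrite [shmul (pure b _) _]shmulC.
have E x y z : pure x (y :: z) = shmul (pure x [::]) (tcons 1 (pure y z)).
  by rewrite tcons_pure shmul_pure wmul0l mulr1.
have Q : shmul (shmul (tcons 1 (pure a1 u)) (tcons 1 (pure b1 v)))
           (tcons 1 (pure c1 w)) =
  shmul (tcons 1 (pure a1 u))
    (shmul (tcons 1 (pure b1 v)) (tcons 1 (pure c1 w))).
  by apply: shmul_baxterA; rewrite ?tcons_pure; apply: IH; rewrite /= in le_n *; lia.
have K x y s t : shmul (shmul (pure x [::]) s) (shmul (pure y [::]) t) =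
    shmul (pure (x * y) [::]) (shmul s t).
  rewrite shmul_eA [shmul s _]shmulC shmul_eA [shmul t s]shmulC.
  by rewrite -shmul_eA shmul_pure wmul0l.
by rewrite (E a a1 u) (E b b1 v) (E c c1 w) !K Q mulrA.
Qed.

Fact shmulA : associative shmul.
Proof.
move=> s t r.
elim/tens_ind: s => [|d a u s IH]; first by rewrite !shmul0l.
rewrite !shmul_linearl IH; congr (_ *: _ + _) => {IH s}.
elim/tens_ind: t => [|e b v t IH]; first by rewrite !(shmul0l, shmul0r).
rewrite !(shmul_linearl, shmul_linearr) IH; congr (_ *: _ + _) => {IH t}.
elim/tens_ind: r => [|e' c w r IH]; first by rewrite !shmul0r.
rewrite !shmul_linearr IH; congr (_ *: _ + _).
by rewrite (shmulA_pure _ _ _ (leqnn _)).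
Qed.

Fact shmul1_neq0 : pure 1 [::] != 0 :> tens A.
Proof.
pose h (a : A) (u : seq A) : A := if u is [::] then a else 0.
have h_ml : multilinear h.
  split=> [d a a' [|? ?]|a [|? ?] d c c' v] //=; by rewrite scaler0 addr0.
apply/eqP => /(congr1 (tlift h)); rewrite (tlift_pure h_ml) (tlift0 h_ml).
by apply/eqP/oner_neq0.
Qed.

End MixableShuffleProduct.

(* The weight lam is a phantom parameter: it selects the product. *)
Definition mshuffle (C : comNzRingType) (lam : C) (A : comAlgType C) : Type :=
  tens A.

Section MixableShuffle.
Variables (C : comNzRingType) (lam : C) (A : comAlgType C).
Notation Sh := (mshuffle lam A).

HB.instance Definition _ := GRing.Lmodule.copy Sh (tens A).
HB.instance Definition _ := GRing.Zmodule_isComNzRing.Build Sh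
  (@shmulA C lam A) (@shmulC C lam A) (@shmul1 C lam A) (@shmulDl C lam A)
  (@shmul1_neq0 C A).

Fact mshuffle_scaleAl (d : C) (s t : Sh) : d *: (s * t) = (d *: s) * t.
Proof. exact: esym (shmulZl lam d s t). Qed.

HB.instance Definition _ :=
  GRing.Lmodule_isLalgebra.Build C Sh mshuffle_scaleAl.
HB.instance Definition _ := GRing.Lalgebra_isComAlgebra.Build C Sh.

(* a_0 \otimes a_1 \otimes ... \otimes a_n *)
Definition otimes (a : A) (u : seq A) : Sh := pure a u.

Definition baxter_op (s : Sh) : Sh := tcons 1 s.

Lemma otimes_nill (a b : A) v : otimes a [::] * otimes b v = otimes (a * b) v.
Proof. exact: shmul_pure. Qed.

Lemma otimes_nilr (a b : A) u : otimes a u * otimes b [::] = otimes (a * b) u.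
Proof. by apply: etrans (shmul_pure _ _ _ _ _) _; rewrite wmulr0. Qed.

Lemma otimes_cons (a0 a1 b0 b1 : A) u v :
  otimes a0 (a1 :: u) * otimes b0 (b1 :: v) =
  tcons (a0 * b0) (otimes a1 u * otimes 1 (b1 :: v)
                   + otimes 1 (a1 :: u) * otimes b1 v
                   + lam *: (otimes a1 u * otimes b1 v)) :> Sh.
Proof.
apply: etrans (shmul_pure _ _ _ _ _) _; rewrite wmul_cons.
by congr (tcons _ (_ + _ + _ *: _)); apply/esym/shmul_pure.
Qed.

Lemma baxter_op_otimes (a : A) u : baxter_op (otimes a u) = otimes 1 (a :: u).
Proof. exact: tcons_pure. Qed.

Lemma baxter_opM (s t : Sh) :
  baxter_op s * baxter_op t =
  baxter_op (s * baxter_op t) + baxter_op (baxter_op s * t)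
  + lam *: baxter_op (s * t).
Proof.
by apply: etrans (tcons_baxter _ _ _) _; rewrite !tconsD tconsZ.
Qed.

End MixableShuffle.

Section StirlingCoefficients.
Variables (C : comNzRingType) (lam : C).

Definition in_index (n : nat) (I : seq nat) : bool :=
  (I != [::]) && (sumn I == n).

(* The element 1 \otimes x^{\otimes I} of the free Baxter algebra on C[x]. *)
Definition one_xI (I : seq nat) : mshuffle lam {poly C} :=
  otimes lam 1 [seq 'X^i | i <- I].

(* (1 \otimes x)^n = \sum_(|I| = n) S I (1 \otimes x^{\otimes I}), the sum being *)
(* finite: S vanishes outside the finite set L of indices.                       *)
Definition stirling_expansion (n : nat) (S : seq nat -> C) : Prop :=
  exists L : seq (seq nat),
    [/\ uniq L,
        (forall I, I \in L -> in_index n I),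
        (forall I, in_index n I -> I \notin L -> S I = 0)
      & otimes lam 1 [:: 'X] ^+ n = \sum_(I <- L) S I *: one_xI I].

Lemma one_x_wmul (J : seq nat) :
  exists s : seq (C * seq nat),
    all (fun p => in_index (sumn J).+1 p.2) s /\
    forall b : {poly C},
      wmul lam [:: 'X] 1 b [seq 'X^i | i <- J]
      = \sum_(p <- s) p.1 *: pure b [seq 'X^i | i <- p.2].
Proof.
elim: J => [|i J [s [Hs Es]]].
  exists [:: (1, [:: 1%N])]; split=> // b.
  by rewrite wmulr0 mul1r big_seq1 scale1r.
exists ((1, [:: 1%N, i & J]) :: (lam, i.+1 :: J)
         :: [seq (p.1, i :: p.2) | p <- s]); split=> [|b].
  rewrite /= /in_index /= add1n addSn !eqxx all_map /=.
  by apply: sub_all Hs => -[c I] /= /andP[_ /eqP ->]; rewrite addnS eqxx.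
rewrite map_cons wmul_cons !wmul0l mul1r mulr1 !tconsD tconsZ !tcons_pure Es.
rewrite !big_cons big_map /= scale1r -exprS -addrA [tcons _ _ + _]addrC.
congr (_ + (_ + _)).
elim: (s) => [|p s' IH]; first by rewrite !big_nil tcons0.
by rewrite !big_cons tcons_linear tcons_pure IH.
Qed.

Lemma one_xS (n : nat) : (0 < n)%N ->
  exists s : seq (C * seq nat),
    all (fun p => in_index n p.2) s /\
    otimes lam 1 [:: 'X] ^+ n = \sum_(p <- s) p.1 *: one_xI p.2.
Proof.
case: n => // n _; elim: n => [|n [s [Hs Es]]].
  by exists [:: (1, [:: 1%N])]; rewrite expr1 big_seq1 scale1r.
rewrite exprS Es => {Es}; elim: s Hs => [_|[c I] s IH /= /andP[HI /IH [s1 [H1 E1]]]].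
  by exists [::]; rewrite !big_nil mulr0.
have [s2 [H2 E2]] := one_x_wmul I.
exists ([seq (c * p.1, p.2) | p <- s2] ++ s1); split.
  rewrite all_cat H1 andbT all_map; apply: sub_all H2 => -[d J] /=.
  by case/andP: HI => _ /eqP ->.
rewrite big_cons mulrDr E1 big_cat big_map /=; congr (_ + _).
rewrite -scalerAr.
have -> : otimes lam 1 [:: 'X] * one_xI I = \sum_(p <- s2) p.1 *: one_xI p.2.
  by apply: etrans (E2 1); apply: shmul_pure.
by rewrite scaler_sumr; apply: eq_bigr => p _; rewrite scalerA.
Qed.

Lemma stirling_expansion_exists (n : nat) :
  (0 < n)%N -> exists S, stirling_expansion n S.
Proof.
case/one_xS => s [Hs Es].
exists (fun I => \sum_(p <- s | p.2 == I) p.1), (undup [seq p.2 | p <- s]).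
split; first exact: undup_uniq.
- by move=> I; rewrite mem_undup => /mapP[p ps ->]; apply: (allP Hs).
- move=> I _; rewrite mem_undup => IN; rewrite big1_seq // => p /andP[/eqP pI ps].
  by case/negP: IN; rewrite -pI map_f.
rewrite Es; under [RHS]eq_bigr => I _ do rewrite scaler_suml.
rewrite (exchange_big_dep predT) //= big_seq [RHS]big_seq.
apply: eq_bigr => p ps.
have pL : p.2 \in undup [seq q.2 | q <- s] by rewrite mem_undup map_f.
rewrite big_mkcond (bigD1_seq p.2) ?undup_uniq //= eqxx big1 ?addr0 // => I.
by rewrite eq_sym => /negPf ->.
Qed.

End StirlingCoefficients.

(* t^n = \sum_(k <= n) S(n, k) t (t - 1) ... (t - k + 1), as polynomials in t. *)
Definition stirling2_spec (S2 : nat -> nat -> int) : Prop :=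
  forall n : nat,
    'X^n = \sum_(k < n.+1) S2 n k *: \prod_(j < k) ('X - (j%:R)%:P) :> {poly int}.

Lemma stirling2_exists : exists S2, stirling2_spec S2.
Proof.
pose fix S (n k : nat) {struct n} : int :=
  match n, k with
  | 0, 0 => 1
  | 0, _.+1 => 0
  | _.+1, 0 => 0
  | n'.+1, k'.+1 => k'.+1%:R * S n' k'.+1 + S n' k'
  end.
have S0 n k : (n < k)%N -> S n k = 0.
  elim: n k => [|n IH] [|k] //= lt_nk.
  by rewrite !IH ?mulr0 ?addr0 // ltnW.
exists S; elim=> [|n IH]; first by rewrite big_ord1 big_ord0 scale1r.
rewrite exprSr IH mulr_suml [RHS]big_ord_recl scale0r add0r.
pose P k : {poly int} := \prod_(j < k) ('X - (j%:R)%:P).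
have PX k : P k * 'X = P k.+1 + k%:R *: P k.
  by rewrite /P big_ord_recr /= mulrBr [_ * _%:P]mulrC mul_polyC subrK.
rewrite (eq_bigr (fun k : 'I_n.+1 =>
  S n k *: P k.+1 + (k%:R * S n k) *: P k)); last first.
  by move=> k _; rewrite -scalerAl PX scalerDr scalerA [_ * k%:R]mulrC.
rewrite big_split /= addrC [X in _ = X](eq_bigr (fun k : 'I_n.+1 =>
  (k.+1%:R * S n k.+1) *: P k.+1 + S n k *: P k.+1)); last first.
  by move=> k _; rewrite -scalerDl.
rewrite big_split /=; congr (_ + _).
rewrite big_ord_recl /= mul0r scale0r add0r [RHS]big_ord_recr /=.
by rewrite S0 // mulr0 scale0r addr0.
Qed.

Definition multinomial (n : nat) (I : seq nat) : nat :=
  n`! %/ \prod_(i <- I) i`!.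

(* Main.v *)
(* Multiplying 1 \otimes x^{\otimes J} by 1 \otimes x inserts an entry 1 at any   *)
(* place of J, or, with weight lam, increments any entry of J. Reading off the    *)
(* coefficient of an index I by a multilinear functional turns this into a       *)
(* recursion in n for S(n, I), which the multinomial formula satisfies by        *)
(* Pascal's rule. Sending instead x to 1 in each word of length k turns it into  *)
(* G(n + 1, k) = k (G(n, k - 1) + lam G(n, k)), with G(n, k) the sum in (2);     *)
(* hence G(n, k) = surj(n, k) lam^(n - k), where surj(n, k) counts surjections   *)
(* from an n-set to a k-set. As m^n = \sum_k surj(n, k) 'C(m, k), evaluating the *)
(* definition of the Stirling numbers at naturals gives surj(n, k) = k! S(n, k). *)

Require Import Defs.
From mathcomp Require Import all_boot all_algebra.
From mathcomp Require Import ring zify.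

Import GRing.Theory.
Local Open Scope ring_scope.

(** Two families of linear functionals read off the expansion: [coef_tens] extracts one coefficient,
    [length_eval] adds up the coefficients of a given length. Each turns multiplication by
    [1 \otimes x] into a recursion ([coef_one_x_mul], [length_eval_one_x_mul]), solved by [weight]
    and by [surj] times a power of [lam]. The identity [stirling2_surj] is proved over the integers,
    so nothing is ever divided in [C]. *)

Section PolynomialTensors.

Set Implicit Arguments.
Unset Strict Implicit.

Variables (C : comNzRingType) (lam : C).
Notation Sh := (mshuffle lam {poly C}).
Notation z := (otimes lam 1 [:: 'X] : Sh).

(** * Coefficients of the powers of [1 \otimes x] *)

Lemma one_x_mul_pure (b : {poly C}) v :
  z * (pure b v : Sh) = wmul lam [:: 'X] 1 b v.
Proof. exact: shmul_pure. Qed.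

Lemma one_x_wmul_cons (b c : {poly C}) v :
  wmul lam [:: 'X] 1 b (c :: v) =
  pure b [:: 'X, c & v] + tcons b (wmul lam [:: 'X] 1 c v)
  + lam *: pure b ('X * c :: v).
Proof.
by rewrite wmul_cons !wmul0l mul1r mulr1 !tconsD tconsZ !tcons_pure.
Qed.

(** The index includes the head factor. Words of another length than [I] get 0, whence the [nilp]
    test and the value 0 at the empty index. *)
Fixpoint word_coef (I : seq nat) (a : {poly C}) (u : seq {poly C}) : C^o :=
  if I is i :: J then
    a`_i * (if u is b :: v then word_coef J b v else (nilp J)%:R)
  else 0.

Lemma regular_scaleE (c x : C) : c *: (x : C^o) = c * x.
Proof. by []. Qed.

Lemma word_coef_ml I : multilinear (word_coef I).
Proof.
split=> [c a a' u|b u c a a' v]; rewrite !regular_scaleE.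
  by case: I => [|i I] /=; rewrite ?coefD ?coefZ; ring.
elim: u b I => [|b' u IH] b [|i I] /=; rewrite ?IH; try ring.
by case: I => [|j I] /=; rewrite ?coefD ?coefZ; ring.
Qed.

Definition coef_tens I : tens {poly C} -> C^o := tlift (word_coef I).

Lemma coef_tens_linear I c s t :
  coef_tens I (c *: s + t) = c *: coef_tens I s + coef_tens I t.
Proof. exact: (tlift_linear (word_coef_ml I)). Qed.

Lemma coef_tens0 I : coef_tens I 0 = 0.
Proof. exact: (tlift0 (word_coef_ml I)). Qed.

Lemma coef_tensD I s t : coef_tens I (s + t) = coef_tens I s + coef_tens I t.
Proof. by rewrite -[s]scale1r coef_tens_linear !scale1r. Qed.

Lemma coef_tens_pure I a u : coef_tens I (pure a u) = word_coef I a u.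
Proof. exact: (tlift_pure (word_coef_ml I)). Qed.

Lemma coef_tens_nil t : coef_tens [::] t = 0.
Proof.
elim/tens_ind: t => [|c a u t IH]; first exact: coef_tens0.
by rewrite coef_tens_linear IH coef_tens_pure scaler0 addr0.
Qed.

Lemma coef_tens_tcons i I a t :
  coef_tens (i :: I) (tcons a t) = a`_i * coef_tens I t.
Proof.
elim/tens_ind: t => [|c b u t IH]; first by rewrite tcons0 !coef_tens0 mulr0.
rewrite tcons_linear !coef_tens_linear IH tcons_pure !coef_tens_pure.
by rewrite mulrDr scalerAr.
Qed.

Lemma coef_one_xI I J : coef_tens (0%N :: I) (one_xI lam J) = (J == I)%:R.
Proof.
rewrite /one_xI /otimes coef_tens_pure.
have E a K L (p : {poly C}) : word_coef (a :: K) p [seq 'X^i | i <- L] =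
    p`_a * (L == K)%:R.
  elim: L K a p => [|j L IH] [|k K] a p //=.
  rewrite -/(word_coef (k :: K) 'X^j [seq 'X^i | i <- L]) IH coefXn.
  by rewrite eqseq_cons eq_sym -natrM mulnb.
by rewrite E coef1 mul1r.
Qed.

(* The transpose, on coefficient functions, of multiplication by 1 \otimes x:    *)
(* an entry 1 was inserted, or, with weight lam, some entry was incremented.     *)
Fixpoint one_x_adjoint (g : seq nat -> C) (I : seq nat) : C :=
  if I is i :: J then
    (i == 1%N)%:R * g J + lam * ((0 < i)%N%:R * g (i.-1 :: J))
    + one_x_adjoint (fun K => g (i :: K)) J
  else 0.

Lemma one_x_adjoint_linear c g h I :
  one_x_adjoint (fun J => c * g J + h J) I =
  c * one_x_adjoint g I + one_x_adjoint h I.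
Proof.
elim: I g h => [|i I IH] g h /=; first by rewrite mulr0 addr0.
by rewrite (IH (fun K => g (i :: K))); ring.
Qed.

Lemma eq_one_x_adjoint g h I : g =1 h -> one_x_adjoint g I = one_x_adjoint h I.
Proof.
elim: I g h => [|i I IH] g h gh //=.
by rewrite !gh (IH _ (fun K => h (i :: K))).
Qed.

(** The head is untouched, since [1 \otimes x] has head 1. On pure tensors, the three summands of
    [one_x_wmul_cons] match those of [one_x_adjoint]. *)
Lemma coef_one_x_mul i I t :
  coef_tens (i :: I) (z * (t : Sh)) =
  one_x_adjoint (fun J => coef_tens (i :: J) t) I.
Proof.
have adj0 g K : (forall J, g J = 0) -> one_x_adjoint g K = 0.
  move=> g0; elim: K g g0 => [|k K IH] g g0 //=.
  by rewrite !g0 !mulr0 !add0r IH.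
elim/tens_ind: t => [|c b v t IH].
  by rewrite (mulr0 z) coef_tens0 adj0 // => J; rewrite coef_tens0.
rewrite (mulrDr z) -scalerAr coef_tens_linear IH.
under [RHS]eq_one_x_adjoint => J do rewrite coef_tens_linear coef_tens_pure.
rewrite one_x_adjoint_linear; congr (_ * _ + _) => {t IH c}.
rewrite one_x_mul_pure.
have sc c g K : one_x_adjoint (fun J => c * g J) K = c * one_x_adjoint g K.
  rewrite -[RHS]addr0 -(adj0 (fun=> 0) K) // -one_x_adjoint_linear.
  by apply: eq_one_x_adjoint => J; rewrite addr0.
elim: v i b I => [|c v IH] i b I.
  rewrite wmulr0 mul1r coef_tens_pure /= sc; congr (_ * _).
  case: I => [|j I] //=; rewrite mulr0 mulr0 addr0 adj0 // addr0.
  by rewrite coefX.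
rewrite one_x_wmul_cons addrC -tcons_pure.
rewrite coef_tens_linear coef_tensD !coef_tens_tcons !coef_tens_pure.
apply: etrans (esym (sc b`_i (fun J => word_coef J c v) I)).
case: I => [|j I]; first by rewrite coef_tens_nil /= regular_scaleE; ring.
rewrite IH /= regular_scaleE coefX coefXM; case: j => [|j] /=; ring.
Qed.

(* The multinomial coefficient times lam ^+ (sumn I - size I), written so that   *)
(* it satisfies a recursion on I, and extended by 0 to indices with a zero entry. *)
Fixpoint weight (I : seq nat) : C :=
  if I is i :: J then
    (0 < i)%N%:R * 'C(i + sumn J, i)%:R * lam ^+ i.-1 * weight J
  else 1.

Lemma weight_sum0 I : sumn I = 0%N -> weight I = (nilp I)%:R.
Proof. by case: I => [|[|i] I] //= _; rewrite !mul0r. Qed.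

(** Fixing the first entry of [g] yields again a function of the sum times [weight]; leaving [a]
    arbitrary is what lets the induction on [I] close. The step is Pascal's rule. *)
Lemma one_x_adjoint_weight (a : nat -> C) (g : seq nat -> C) I :
  (forall J, g J = a (sumn J) * weight J) ->
  one_x_adjoint g I = a (sumn I).-1 * (~~ nilp I)%:R * weight I.
Proof.
elim: I a g => [|i I IH] a g gE /=; first by rewrite mulr0 mul0r.
rewrite !gE /=.
rewrite (IH (fun m => a (i + m)%N * (0 < i)%N%:R * 'C(i + m, i)%:R * lam ^+ i.-1));
  last by move=> J; rewrite gE /=; ring.
case: i => [|i]; rewrite ?addSn /=; first by ring.
(* The predecessor truncates at sum 0, where [weight I] is 1 or 0 according as [I] is empty or
   not. *)
have [s0|s_gt0] := posnP (sumn I).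
  rewrite !weight_sum0 // s0 !addn0 !binn.
  case: i => [|i] /=; rewrite ?addn0 ?binn ?exprS; case: (nilp I) => /=; ring.
have -> : nilp I = false by case: I s_gt0 {IH}.
have [m sE] : exists m, sumn I = m.+1 by exists (sumn I).-1; rewrite prednK.
rewrite sE /= !addnS [in RHS]binS natrD.
(* For a first entry 1, decrementing gives weight 0, and the insertion term supplies the missing
   Pascal summand. *)
case: i => [|i] /=; rewrite ?bin0 ?exprS; ring.
Qed.

Lemma coef_one_x_exp n I :
  coef_tens (0%N :: I) (z ^+ n) = (sumn I == n)%:R * weight I.
Proof.
elim: n I => [|n IH] I.
  rewrite expr0 [LHS]coef_tens_pure /= coef1 mul1r.
  by case: eqP => [/weight_sum0 -> | ]; case: I => // *; rewrite ?mul0r ?mul1r.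
rewrite exprS coef_one_x_mul (@one_x_adjoint_weight (fun m => (m == n)%:R)) //.
case: (posnP (sumn I)) => [s0|s_gt0].
  by rewrite weight_sum0 // s0; case: (nilp I); rewrite ?mulr0 ?mul0r.
have -> : nilp I = false by case: I s_gt0.
by rewrite mulr1 -[X in X == n.+1]prednK.
Qed.

Lemma weight_pos I : all (fun i => 0 < i)%N I ->
  weight I = (multinomial (sumn I) I)%:R * lam ^+ (sumn I - size I).
Proof.
move=> I_gt0.
(* [multinomial] is a truncated quotient, so exact divisibility is carried along as the witness [m],
   a product of binomials. *)
have [m mI wI] : exists2 m, (sumn I)`! = (m * \prod_(i <- I) i`!)%N &
    weight I = m%:R * lam ^+ (sumn I - size I).
  elim: I I_gt0 => [_|i I IH /= /andP[i_gt0 /[dup] I_gt0 /IH[m mI ->]]].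
    by exists 1%N; rewrite ?big_nil ?mul1r.
  exists ('C(i + sumn I, i) * m)%N.
    by rewrite big_cons -(bin_fact (leq_addr (sumn I) i)) addKn mI; lia.
  have le_I : (size I <= sumn I)%N.
    by elim: I I_gt0 {IH mI} => //= j I IH /andP[? /IH]; lia.
  have -> : (i + sumn I - (size I).+1 = i.-1 + (sumn I - size I))%N by lia.
  by rewrite i_gt0 mul1r natrM exprD; ring.
rewrite wI /multinomial mI mulnK //.
by apply: prodn_gt0 => i; apply: fact_gt0.
Qed.

(** * Sums over indices of a fixed length *)

Definition word_length_eval k (a : {poly C}) (u : seq {poly C}) : C^o :=
  (size u == k)%:R * (a.[1] * \prod_(b <- u) b.[1]).

Lemma word_length_eval_ml k : multilinear (word_length_eval k).
Proof.
split=> [c a a' u|b u c a a' v]; rewrite !regular_scaleE /word_length_eval.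
  by rewrite hornerD hornerZ; ring.
by rewrite !size_cat !big_cat !big_cons /= hornerD hornerZ; ring.
Qed.

(* The leading factor is not counted: k refers to the words 1 \otimes x^{\otimes I} *)
(* with I of length k, all of which are sent to 1.                               *)
Definition length_eval k : tens {poly C} -> C^o := tlift (word_length_eval k).

Lemma length_eval_linear k c s t :
  length_eval k (c *: s + t) = c *: length_eval k s + length_eval k t.
Proof. exact: (tlift_linear (word_length_eval_ml k)). Qed.

Lemma length_eval0 k : length_eval k 0 = 0.
Proof. exact: (tlift0 (word_length_eval_ml k)). Qed.

Lemma length_evalD k s t :
  length_eval k (s + t) = length_eval k s + length_eval k t.
Proof. by rewrite -[s]scale1r length_eval_linear !scale1r. Qed.

Lemma length_eval_pure k a u : length_eval k (pure a u) = word_length_eval k a u.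
Proof. exact: (tlift_pure (word_length_eval_ml k)). Qed.

Lemma length_eval_tcons k a t :
  length_eval k (tcons a t) = (0 < k)%N%:R * (a.[1] * length_eval k.-1 t).
Proof.
elim/tens_ind: t => [|c b u t IH]; first by rewrite tcons0 !length_eval0 !mulr0.
rewrite tcons_linear !length_eval_linear IH tcons_pure !length_eval_pure.
rewrite !regular_scaleE /word_length_eval big_cons.
by case: k {IH} => [|k] /=; rewrite ?eqSS; ring.
Qed.

(** Evaluation at 1 ignores exponents, so it only counts: a tail of length [k - 1] has [k] places
    for an insertion, one of length [k] has [k] entries to multiply by [x]. *)
Lemma length_eval_one_x_mul k t :
  length_eval k (z * (t : Sh)) =
  k%:R * (length_eval k.-1 t + lam * length_eval k t).
Proof.
elim/tens_ind: t => [|c b v t IH].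
  by rewrite (mulr0 z) !length_eval0 !(mulr0, addr0).
rewrite (mulrDr z) -scalerAr !length_eval_linear IH one_x_mul_pure.
rewrite !length_eval_pure !regular_scaleE.
suff -> : length_eval k (wmul lam [:: 'X] 1 b v) =
    k%:R * (word_length_eval k.-1 b v + lam * word_length_eval k b v) by ring.
rewrite /word_length_eval {IH t c}.
elim: v b k => [|c v IH] b k.
  rewrite wmulr0 mul1r length_eval_pure /word_length_eval big_seq1 big_nil hornerX.
  by case: k => [|[|k]] /=; ring.
rewrite one_x_wmul_cons addrC length_eval_linear length_evalD length_eval_tcons IH.
rewrite !length_eval_pure regular_scaleE /word_length_eval !big_cons.
rewrite hornerM hornerX /=.
case: k => [|k] /=; first by ring.
rewrite !eqSS; case: k => [|k] /=; rewrite -?natr1 ?eqSS; ring.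
Qed.

(** The last point has [j.+1] possible images; the other [m] points cover either all values or all
    but that one. *)
Fixpoint surj (n k : nat) : nat :=
  match n, k with
  | 0, 0 => 1
  | m.+1, j.+1 => j.+1 * (surj m j + surj m j.+1)
  | _, _ => 0
  end.

Lemma surj_small n k : (n < k)%N -> surj n k = 0%N.
Proof.
elim: n k => [|n IH] [|k] //= lt_nk.
by rewrite !IH ?muln0 // ltnW.
Qed.

Lemma length_eval_one_x_exp n k :
  length_eval k (z ^+ n) = (surj n k)%:R * lam ^+ (n - k).
Proof.
elim: n k => [|n IH] k.
  rewrite expr0 [LHS]length_eval_pure /word_length_eval big_nil hornerC !mulr1.
  by case: k => [|k]; rewrite ?mulr1 ?mul0r.
rewrite exprS length_eval_one_x_mul !IH.
case: k => [|k] /=; first by rewrite !mul0r.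
(* When [n <= k] the exponent [n - k.+1] truncates, but [surj n k.+1] is then 0. *)
rewrite subSS natrM natrD; case: (ltnP k n) => [lt_kn|le_nk].
  by rewrite -(subnSK lt_kn) exprS; ring.
by rewrite (@surj_small n k.+1) //; ring.
Qed.
End PolynomialTensors.

(** * Surjections and Stirling numbers *)

(** This sorts the maps from an [n]-set to an [m]-set by the size [k] of their image; the induction
    rests on the identity [mC]. *)
Lemma surj_bin_expansion m n :
  (m ^ n = \sum_(k < n.+1) surj n k * 'C(m, k))%N.
Proof.
elim: n => [|n IH]; first by rewrite big_ord1 bin0.
rewrite expnSr IH big_distrl /= [RHS]big_ord_recl /= mul0n add0n.
pose f k := (k * surj n k * 'C(m, k))%N.
have E : (\sum_(k < n.+1) f k = \sum_(k < n.+1) f k.+1)%N.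
  rewrite big_ord_recl [RHS]big_ord_recr /= /f.
  by rewrite (surj_small (ltnSn n)) !(muln0, mul0n) addn0.
transitivity (\sum_(k < n.+1) (f k + k.+1 * surj n k * 'C(m, k.+1)))%N.
  apply: eq_bigr => k _; rewrite /f.
  have mC : ('C(m, k) * m = k * 'C(m, k) + k.+1 * 'C(m, k.+1))%N.
    rewrite mul_bin_left -mulnDl mulnC; case: (leqP k m) => [le_km | lt_mk].
      by rewrite subnKC.
    by rewrite bin_small // !muln0.
  by rewrite -mulnA mC; ring.
rewrite big_split /= E -big_split /=; apply: eq_bigr => k _.
by rewrite /f /bump /= add1n; ring.
Qed.

Lemma horner_falling_prod (m k : nat) :
  (\prod_(j < k) ('X - (j%:R)%:P) : {poly int}).[m%:R] = (k`! * 'C(m, k))%:R.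
Proof.
rewrite horner_prod mulnC bin_ffact.
elim: k => [|k IH]; first by rewrite big_ord0 ffactn0.
rewrite big_ord_recr /= {}IH !hornerE ffactnSr natrM.
case: (leqP k m) => [le_km | lt_mk]; first by rewrite natrB.
by rewrite ffact_small // !mul0r.
Qed.

(** The system is unitriangular: at [m = k] only the terms [j <= k] survive, and ['C(k, k) = 1]. *)
Lemma bin_expansion_inj n (f g : nat -> int) :
  (forall m : nat, \sum_(k < n) f k * 'C(m, k)%:R =
                   \sum_(k < n) g k * 'C(m, k)%:R) ->
  forall k, (k < n)%N -> f k = g k.
Proof.
move=> fg k; elim/ltn_ind: k => k IH lt_kn.
have := fg k; rewrite (bigD1 (Ordinal lt_kn)) // [RHS](bigD1 (Ordinal lt_kn)) //=.
rewrite binn !mulr1.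
rewrite (eq_bigr (fun j : 'I_n => g j * 'C(k, j)%:R)) => [/addIr //|j neq_jk].
have [lt_jk | lt_kj | eq_jk] := ltngtP j k; first by rewrite IH.
  by rewrite bin_small // !mulr0.
by case/eqP: neq_jk; apply: val_inj.
Qed.

Lemma stirling2_surj (S2 : nat -> nat -> int) n k : stirling2_spec S2 ->
  (k <= n)%N -> k`!%:R * S2 n k = (surj n k)%:R.
Proof.
move=> hS2 le_kn.
apply: (@bin_expansion_inj n.+1 (fun k => k`!%:R * S2 n k)
  (fun k => (surj n k)%:R)) => // m.
have /(congr1 (horner^~ m%:R)) := hS2 n.
rewrite hornerXn horner_sum -natrX surj_bin_expansion natr_sum => E.
under [RHS]eq_bigr => j _ do rewrite -natrM.
rewrite E; apply: eq_bigr => j _.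
by rewrite hornerZ horner_falling_prod natrM; ring.
Qed.

(** * Applying the functionals to a given expansion *)

Section Expansion.
Variables (C : comNzRingType) (lam : C) (n : nat) (Sn : seq nat -> C).
Hypothesis hSn : stirling_expansion lam n Sn.

Lemma stirling_coefE I : in_index n I -> Sn I = weight lam I.
Proof.
move=> nI; have [L [uL _ SN E]] := hSn.
have := coef_one_x_exp lam n I; rewrite E.
case/andP: (nI) => _ ->; rewrite mul1r => <-.
have {E}-> : coef_tens (0%N :: I) (\sum_(J <- L) Sn J *: one_xI lam J) =
    \sum_(J <- L) Sn J * (J == I)%:R.
  elim: (L) => [|J s IH]; first by rewrite !big_nil coef_tens0.
  by rewrite !big_cons coef_tens_linear IH coef_one_xI.
case: (boolP (I \in L)) => [IL | /[dup] IL /(SN _ nI) ->].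
  rewrite (bigD1_seq I) //= eqxx mulr1 big1 ?addr0 // => J /negPf ->.
  exact: mulr0.
rewrite big1_seq // => J /andP[_ JL]; case: eqP => [JI|]; last by rewrite mulr0.
by rewrite -JI JL in IL.
Qed.

Lemma sum_stirling_coef_length k : (0 < k)%N ->
  \sum_(I : k.-tuple 'I_n.+1 | sumn [seq val i | i <- I] == n)
     Sn [seq val i | i <- I] = (surj n k)%:R * lam ^+ (n - k).
Proof.
move=> k_gt0; have [L [uL Ln SN E]] := hSn.
have := length_eval_one_x_exp lam n k; rewrite E => <-.
have {E}-> : length_eval k (\sum_(J <- L) Sn J *: one_xI lam J) =
    \sum_(J <- L | size J == k) Sn J.
  elim: (L) => [|J s IH]; first by rewrite !big_nil length_eval0.
  rewrite !big_cons length_eval_linear IH [length_eval k _]length_eval_pure.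
  rewrite /word_length_eval size_map hornerC big_map big1 => [|i _]; last first.
    by rewrite hornerXn expr1n.
  by rewrite !mulr1 regular_scaleE; case: eqP; rewrite ?mulr1 ?mulr0 ?add0r.
pose tn := [pred I : k.-tuple 'I_n.+1 | sumn [seq val i | i <- I] == n].
pose words := [seq [seq val i | i <- tval t] | t <- enum tn].
have wordsP J : (J \in words) = (size J == k) && (sumn J == n).
  apply/mapP/andP => [[t] | [/eqP Jk /eqP Jn]].
    by rewrite mem_enum inE => tn_t ->; rewrite size_map size_tuple.
  (* Entries of an index of sum [n] are at most [n], so they fit in ['I_n.+1]. *)
  have JE : [seq val i | i <- [seq inord i : 'I_n.+1 | i <- J]] = J.
    rewrite -map_comp; apply: map_id_in => j jJ /=; rewrite inordK // ltnS.
    by rewrite -Jn; elim: (J) jJ => //= i s IH; rewrite inE => /predU1P[->|/IH]; lia.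
  have sz : size [seq inord i : 'I_n.+1 | i <- J] == k by rewrite size_map Jk.
  by exists (Tuple sz); rewrite ?mem_enum ?inE /= JE // Jn.
have words_uniq : uniq words.
  rewrite map_inj_uniq ?enum_uniq // => I J /inj_map IJ.
  by apply/val_inj/IJ/val_inj.
transitivity (\sum_(J <- words) Sn J).
  by rewrite big_map big_enum.
(* Indices outside [L] contribute 0; [k > 0] ensures that they are nonempty. *)
rewrite (bigID (mem L)) /= addrC big1_seq ?add0r => [|J /andP[JL]]; last first.
  rewrite wordsP => /andP[/eqP Jk Jn]; apply: SN => //; rewrite /in_index Jn andbT.
  by rewrite -size_eq0 Jk -lt0n.
rewrite -big_filter -[RHS]big_filter; apply: perm_big; apply: uniq_perm.
- exact: filter_uniq.
- exact: filter_uniq.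
move=> J; rewrite !mem_filter wordsP.
by case JL: (J \in L); rewrite ?andbF //; case/andP: (Ln J JL) => _ ->; rewrite !andbT.
Qed.
End Expansion.

Theorem theorem3p2 (C : comNzRingType) (lam : C) (n : nat) (hn : (1 <= n)%N)
    (Sn : seq nat -> C) (hSn : stirling_expansion lam n Sn)
    (S2 : nat -> nat -> int) (hS2 : stirling2_spec S2) :
  (forall I : seq nat, in_index n I -> all (fun i => 0 < i)%N I ->
     Sn I = (multinomial n I)%:R * lam ^+ (n - size I)) /\
  (forall k : nat, (1 <= k <= n)%N ->
     \sum_(I : k.-tuple 'I_n.+1 | sumn [seq val i | i <- I] == n)
        Sn [seq val i | i <- I]
     = (k`!)%:R * (S2 n k)%:~R * lam ^+ (n - k)).
Proof.
split=> [I nI I_gt0 | k /andP[k_gt0 le_kn]].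
  by rewrite (stirling_coefE hSn nI) weight_pos //; case/andP: nI => _ /eqP ->.
rewrite (sum_stirling_coef_length hSn k_gt0); congr (_ * _).
(* The integer identity is transported along the ring map from the integers to [C]. *)
have /(congr1 (intr : int -> C)) := stirling2_surj hS2 le_kn.
by rewrite rmorphM !rmorph_nat => ->.
Qed.
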